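(* Let $F$ be any field, and let $F(x)$ be the field of rational functions in $x$ over $F$. Let $G$ be any finite subgroup of $PGL(2,F)$. Let $\Phi(x)=f(x)/g(x)$ be a generator of the field $F(x)^G$ of fixed points of the $G$-action, where $f,g\in F[x]$ are relatively prime, $f$ is monic of degree $|G|$, and $\deg g<|G|$. Then $P_G(T)=f(T)-\Phi(x)g(T)$, the group $G$ is the Galois group of $P_G(T)$ over $F(\Phi(x))$, and $F(x)$ is the splitting field of $P_G(T)$ over $F(\Phi(x))$.
   Context: $PGL(2,F)$ acts as the group of $F$-automorphisms of $F(x)$: the element represented by $s(x)=\frac{ax+b}{cx+d}$ ($ad-bc\ne 0$) sends $r(x)$ to $r(s(x))$. A generator of $F(x)^G$ is an element $\Phi(x)$ with $F(x)^G=F(\Phi(x))$. The orbit polynomial of $G$ is $P_G(T)=\prod_{s\in G}(T-s(x))$, where $s(x)$ is the image of $x$ under $s$. *)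

(* Defs.v *)
From HB Require Import structures.
From mathcomp Require Import all_boot all_order all_algebra separable.
From mathcomp Require Import finmap.
From mathcomp Require Import boolp classical_sets functions.

Set Implicit Arguments.
Unset Strict Implicit.
Unset Printing Implicit Defensive.

Import GRing.Theory.
Local Open Scope classical_set_scope.
Local Open Scope ring_scope.
Local Open Scope quotient_scope.

(* The groups 'GL_n[R] of MathComp require R to be finite. *)
Record GL (n : nat) (F : fieldType) : Type :=
  MkGL { GLmx :> 'M[F]_n; GLmx_unit : GLmx \in unitmx }.
HB.instance Definition _ n F := [isSub for @GLmx n F].
HB.instance Definition _ n F := [Choice of GL n F by <:].

Section PGL.
Variables (n : nat) (F : fieldType).
Implicit Types A B C : GL n F.

Definition GL_prop A B : bool :=
  `[< exists2 c : F, c != 0 & GLmx B = c *: GLmx A >].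

Lemma GL_propP A B :
  reflect (exists2 c : F, c != 0 & GLmx B = c *: GLmx A) (GL_prop A B).
Proof. exact: asboolP. Qed.

Lemma GL_prop_refl : reflexive GL_prop.
Proof. by move=> A; apply/GL_propP; exists 1; rewrite ?oner_neq0 ?scale1r. Qed.

Lemma GL_prop_symP A B : GL_prop A B -> GL_prop B A.
Proof.
move=> /GL_propP[c c0 E]; apply/GL_propP; exists c^-1; first by rewrite invr_eq0.
by rewrite E scalerA mulVf ?scale1r.
Qed.

Lemma GL_prop_sym : symmetric GL_prop.
Proof. by move=> A B; apply/idP/idP; apply: GL_prop_symP. Qed.

Lemma GL_prop_trans : transitive GL_prop.
Proof.
move=> B A C /GL_propP[c c0 E] /GL_propP[d d0 E']; apply/GL_propP.
by exists (d * c); rewrite ?mulf_neq0 // E' E scalerA.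
Qed.

Definition GL_prop_equiv := EquivRel GL_prop GL_prop_refl GL_prop_sym GL_prop_trans.
Canonical GL_prop_equiv.

Definition PGL := {eq_quot GL_prop}.
HB.instance Definition _ : EqQuotient _ GL_prop PGL := EqQuotient.on PGL.
HB.instance Definition _ := Choice.on PGL.

Lemma PGL_eqP A B : reflect (\pi_PGL A = \pi_PGL B) (GL_prop A B).
Proof. by rewrite -eqmodE; apply: eqP. Qed.

Lemma PGL_piP A B : GLmx A = GLmx B -> \pi_PGL A = \pi_PGL B.
Proof. by move/val_inj->. Qed.

Definition GL_one : GL n F := MkGL (unitmx1 F n).
Definition GL_mul A B : GL n F :=
  MkGL (etrans (unitmx_mul A B) (introT andP (conj (GLmx_unit A) (GLmx_unit B)))).
Definition GL_inv A : GL n F := MkGL (etrans (unitmx_inv A) (GLmx_unit A)).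

Definition PGL_one : PGL := \pi_PGL GL_one.
Definition PGL_mul (s t : PGL) : PGL := \pi_PGL (GL_mul (repr s) (repr t)).
Definition PGL_inv (s : PGL) : PGL := \pi_PGL (GL_inv (repr s)).

Lemma PGL_mulE A B : PGL_mul (\pi_PGL A) (\pi_PGL B) = \pi_PGL (GL_mul A B).
Proof.
apply/PGL_eqP; case: piP => A' /PGL_eqP /GL_propP[c c0 Ec].
case: piP => B' /PGL_eqP /GL_propP[d d0 Ed].
apply: GL_prop_symP; apply/GL_propP; exists (c * d); first by rewrite mulf_neq0.
by rewrite /= Ec Ed -scalemxAr -scalemxAl scalerA mulrC.
Qed.

Lemma PGL_invE A : PGL_inv (\pi_PGL A) = \pi_PGL (GL_inv A).
Proof.
apply/PGL_eqP; case: piP => A' /PGL_eqP /GL_propP[c c0 Ec].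
apply: GL_prop_symP; apply/GL_propP; exists c^-1; first by rewrite invr_eq0.
by rewrite /= Ec invmxZ // unitmxZ ?unitfE ?GLmx_unit.
Qed.

Lemma PGL_mulA : associative PGL_mul.
Proof.
elim/quotW=> A; elim/quotW=> B; elim/quotW=> C.
rewrite (PGL_mulE B C) (PGL_mulE A B) (PGL_mulE A) (PGL_mulE _ C).
by apply: PGL_piP; rewrite /= mulmxA.
Qed.

Lemma PGL_mul1g : left_id PGL_one PGL_mul.
Proof.
by elim/quotW=> A; rewrite (PGL_mulE _ A); apply: PGL_piP; rewrite /= mul1mx.
Qed.

Lemma PGL_mulg1 : right_id PGL_one PGL_mul.
Proof.
by elim/quotW=> A; rewrite (PGL_mulE A); apply: PGL_piP; rewrite /= mulmx1.
Qed.

Lemma PGL_mulVg : left_inverse PGL_one PGL_inv PGL_mul.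
Proof.
elim/quotW=> A; rewrite (PGL_invE A) (PGL_mulE _ A).
by apply: PGL_piP; rewrite /= mulVmx ?GLmx_unit.
Qed.

Lemma PGL_mulgV : right_inverse PGL_one PGL_inv PGL_mul.
Proof.
elim/quotW=> A; rewrite (PGL_invE A) (PGL_mulE A).
by apply: PGL_piP; rewrite /= mulmxV ?GLmx_unit.
Qed.

HB.instance Definition _ :=
  isGroup.Build PGL PGL_mulA PGL_mul1g PGL_mulg1 PGL_mulVg PGL_mulgV.

End PGL.

Notation ratfun F := {fraction {poly F}}.

Section RationalFunctions.
Variable F : fieldType.

Definition ratC (c : F) : ratfun F := tofrac c%:P.
Definition ratX : ratfun F := tofrac 'X.

(* p(y), for p in F[T] and y in F(x); for instance p(T) itself, seen in F(x)[T],
   is map_poly ratC p. *)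
Definition poly_subst (p : {poly F}) (y : ratfun F) : ratfun F :=
  (map_poly ratC p).[y].

(* r(y). The value does not depend on the fraction representing r as soon as y is
   not a constant, which is the only case of interest: y is a Moebius map below. *)
Definition rat_subst (r y : ratfun F) : ratfun F :=
  poly_subst \n_(repr r) y / poly_subst \d_(repr r) y.

Definition moebius_mx (A : 'M[F]_2) : ratfun F :=
  tofrac ((A 0 0)%:P * 'X + (A 0 1)%:P) / tofrac ((A 1 0)%:P * 'X + (A 1 1)%:P).

Definition moebius (s : PGL 2 F) : ratfun F := moebius_mx (GLmx (repr s)).

Lemma moebiusE (A : GL 2 F) : moebius (\pi_(PGL 2 F) A) = moebius_mx A.
Proof.
rewrite /moebius; case: piP => B /PGL_eqP /GL_propP[c c0 ->].
rewrite /moebius_mx !mxE !polyCM -!mulrA -!mulrDr !tofracM invfM mulrACA.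
by rewrite divff ?mul1r // tofrac_eq0 polyC_eq0.
Qed.

Definition PGL_act (s : PGL 2 F) (r : ratfun F) : ratfun F :=
  rat_subst r (moebius s).

Definition fixed_field (G : {fset PGL 2 F}) : set (ratfun F) :=
  [set r | forall s, s \in G -> PGL_act s r = r].

Definition orbit_poly (G : {fset PGL 2 F}) : {poly ratfun F} :=
  \prod_(s <- G) ('X - (PGL_act s ratX)%:P).

End RationalFunctions.

Section Galois.
Variable L : fieldType.
Implicit Types (K S : set L) (p : {poly L}).

Definition subfield K : Prop := divring_closed (mem K).

Definition field_adjoin K S : set L := smallest subfield (K `|` S).

(* The same condition as splittingFieldFor in galois.v, which is restricted to
   finite-dimensional extensions. *)
Definition is_splitting_field K p : Prop :=
  (forall i, K p`_i) /\
  exists2 rs : seq L, p %= \prod_(z <- rs) ('X - z%:P)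
                    & field_adjoin K [set` rs] = [set: L].

Definition field_aut K : set (L -> L) :=
  [set phi | [/\ zmod_morphism phi, monoid_morphism phi, bijective phi
               & {in K, forall y, phi y = y}]].

(* The group G, acting on L through [to], is the Galois group over K of the
   separable polynomial p, with splitting field L.  As for the groups 'Gal(E / K)
   of MathComp, a product s * t stands for s followed by t. *)
Definition is_galois_group (gT : groupType) (G : set gT) (to : gT -> L -> L)
    K p : Prop :=
  [/\ separable_poly p, is_splitting_field K p,
      {in G &, forall s t, to (s * t)%g = to t \o to s}
    & set_bij G (field_aut K) to].

End Galois.

Definition rat_adjoin (F : fieldType) (Phi : ratfun F) : set (ratfun F) :=
  field_adjoin (range (@ratC F)) [set Phi].

(* Main.v *)
Require Import Defs.
From mathcomp Require Import all_boot all_order all_algebra.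
From mathcomp Require Import finmap.
From mathcomp Require Import boolp classical_sets functions.
From HB Require Import structures.
From mathcomp Require Import generic_quotient ring separable.

(** Both sides of P_G(T) = f(T) - Phi(x) g(T) are monic of degree |G|, so it is
    enough that they have the same |G| distinct roots.  The images s(x), for s in
    G, are pairwise distinct because the Moebius map of s determines s
    ([moebius_inj]); and they are roots of the right-hand side because s fixes
    Phi, that is, f(s(x)) / g(s(x)) = Phi.

    The Galois statement then rests on one principle: a ring endomorphism of F(x)
    that fixes F is determined by the image of x ([ratfun_rmorph_ext]).  It shows
    that substitution turns products of matrices into compositions of maps
    ([PGL_actM]), so that each s acts by an automorphism.  Conversely, an
    automorphism phi that fixes F(Phi) = F(x)^G fixes the coefficients of P_G, so
    it sends the root x to another root s(x); hence phi agrees with s at x, and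
    everywhere.  Since x is itself a root of P_G, the roots of P_G generate F(x)
    over F(Phi).

    All this needs that r(s(x)) is meaningful and multiplicative in r, which
    holds because s(x) is transcendental over F ([moebius_transcendental]): x is a
    rational expression in s(x) with coefficients in F, so that x would be
    algebraic over F if s(x) were. *)

Set Implicit Arguments.
Unset Strict Implicit.
Unset Printing Implicit Defensive.

Import GRing.Theory.
Local Open Scope classical_set_scope.
Local Open Scope ring_scope.

(** * Endomorphisms of F(x) over F *)

HB.instance Definition _ (F : fieldType) :=
  GRing.RMorphism.copy (@ratC F) (@tofrac {poly F} \o polyC).

Lemma poly_subst_ratX (F : fieldType) (p : {poly F}) :
  poly_subst p (ratX F) = tofrac p.
Proof.
rewrite /poly_subst /ratX map_poly_comp horner_map /=; congr tofrac.
exact: comp_polyXr.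
Qed.

(** The definition of [rat_subst] reads the numerator and denominator off the
    representative that the quotient chooses for r, whence this explicit form. *)
Lemma ratfun_numdenE (F : fieldType) (r : ratfun F) :
  r = tofrac \n_(repr r) / tofrac \d_(repr r).
Proof.
have q0 := denom_ratioP (repr r).
apply/esym/(canLR (mulfK _)); first by rewrite tofrac_eq0.
rewrite -{2}[r]reprK; unlock tofrac.
rewrite -[RHS]FracField.pi_mul; apply/eqmodP => /=.
rewrite FracField.equivfE /FracField.mulf.
by rewrite !numden_Ratio ?mul1r ?mulr1 ?oner_neq0 // mulrC.
Qed.

Lemma ratfunP (F : fieldType) (r : ratfun F) :
  exists p q : {poly F}, q != 0 /\ r = tofrac p / tofrac q.
Proof.
exists \n_(repr r), \d_(repr r); split; first exact: denom_ratioP.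
exact: ratfun_numdenE.
Qed.

Lemma rmorph_tofrac (F : fieldType) (phi : {rmorphism ratfun F -> ratfun F})
    (p : {poly F}) : (forall c, phi (ratC c) = ratC c) ->
  phi (tofrac p) = poly_subst p (phi (ratX F)).
Proof.
move=> phiC; rewrite -poly_subst_ratX /poly_subst -horner_map -map_poly_comp.
by congr (_.[_]); apply: eq_map_poly.
Qed.

(** F(x) is generated by F and x as a field, and morphisms of fields commute with
    inverses. *)
Lemma ratfun_rmorph_ext (F : fieldType) (phi psi : {rmorphism ratfun F -> ratfun F}) :
  (forall c, phi (ratC c) = ratC c) -> (forall c, psi (ratC c) = ratC c) ->
  phi (ratX F) = psi (ratX F) -> phi =1 psi.
Proof.
move=> phiC psiC eqX r; have [p [q [_ ->]]] := ratfunP r.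
by rewrite (fmorph_div phi) (fmorph_div psi) (rmorph_tofrac p phiC)
  (rmorph_tofrac q phiC) (rmorph_tofrac p psiC) (rmorph_tofrac q psiC) eqX.
Qed.

(** * Moebius maps are transcendental over F *)

Lemma ratX_transcendental (F : fieldType) :
  ~ algebraicOver (@ratC F) (ratX F).
Proof.
move=> [p p0] /eqP; rewrite -[_.[_]]/(poly_subst p (ratX F)) poly_subst_ratX.
by apply/eqP; rewrite tofrac_eq0.
Qed.

Lemma GL2_det_neq0 (F : fieldType) (A : GL 2 F) :
  A 0 0 * A 1 1 - A 0 1 * A 1 0 != 0.
Proof.
have := GLmx_unit A.
rewrite unitmxE unitfE (expand_det_row _ 0) !big_ord_recl big_ord0 addr0 /cofactor.
rewrite !det_mx11 !mxE /= expr0 mul1r expr1 mulN1r mulrN.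
have e1 : lift ord0 ord0 = 1 :> 'I_2 by exact: val_inj.
have e0 : lift (lift ord0 ord0) ord0 = 0 :> 'I_2 by exact: val_inj.
by rewrite e0 e1.
Qed.

Lemma GL2_denom_neq0 (F : fieldType) (A : GL 2 F) :
  ratC (A 1 0) * ratX F + ratC (A 1 1) != 0.
Proof.
rewrite /ratC /ratX -tofracM -tofracD tofrac_eq0.
apply: contra_neq (GL2_det_neq0 A) => E.
have := congr1 (fun p : {poly F} => p`_0) E.
have := congr1 (fun p : {poly F} => p`_1) E.
rewrite !coefD !coefMX !coefC /= addr0 add0r => -> ->.
by rewrite !mulr0 subr0.
Qed.

Lemma moebius_mxE (F : fieldType) (A : 'M[F]_2) :
  moebius_mx A = (ratC (A 0 0) * ratX F + ratC (A 0 1))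
               / (ratC (A 1 0) * ratX F + ratC (A 1 1)).
Proof. by rewrite /moebius_mx !tofracD !tofracM. Qed.

(** Solving y = (a x + b) / (c x + d) for x gives x = (d y - b) / (a - c y), so x
    would be algebraic over F if y were.  The denominator is nonzero since
    (a - c y) (c x + d) = a d - b c. *)
Lemma moebius_transcendental (F : fieldType) (s : PGL 2 F) :
  ~ algebraicOver (@ratC F) (moebius s).
Proof.
rewrite /moebius; move: (repr s) => A y_alg.
apply: (@ratX_transcendental F).
have := GL2_denom_neq0 A; have := GL2_det_neq0 A; move: y_alg.
rewrite moebius_mxE; set y := _ / _.
set a := A 0 0; set b := A 0 1; set c := A 1 0; set d := A 1 1.
move=> y_alg det0 den0.
have y_cleared : y * (ratC c * ratX F + ratC d) = ratC a * ratX F + ratC b.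
  by rewrite divfK.
have den_inv0 : ratC a - ratC c * y != 0.
  apply: contra_neq det0 => E; apply/eqP; rewrite -polyC_eq0 -tofrac_eq0.
  rewrite -[tofrac _]/(ratC _) rmorphB !rmorphM /=; apply/eqP.
  by rewrite (_ : _ - _ = (ratC a - ratC c * y) * (ratC c * ratX F + ratC d));
    [rewrite E mul0r | rewrite mulrBl -mulrA y_cleared; ring].
have -> : ratX F = (ratC d * y - ratC b) / (ratC a - ratC c * y).
  apply: (canRL (mulfK den_inv0)).
  have -> : ratC b = y * (ratC c * ratX F + ratC d) - ratC a * ratX F.
    by rewrite y_cleared; ring.
  by ring.
have C_alg e : algebraicOver (@ratC F) (ratC e) by exact: (algebraic_id (@ratC F)).
exact: (algebraic_div (algebraic_sub (algebraic_mul (C_alg d) y_alg) (C_alg b))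
          (algebraic_sub (C_alg a) (algebraic_mul (C_alg c) y_alg))).
Qed.

Lemma poly_subst_moebius_neq0 (F : fieldType) (s : PGL 2 F) (p : {poly F}) :
  p != 0 -> poly_subst p (moebius s) != 0.
Proof.
move=> p0; apply/eqP => E; apply: (@moebius_transcendental F s).
by exists p => //; apply/eqP.
Qed.

(** * The action of PGL(2,F) on F(x) *)

(** Since s(x) is transcendental over F, denominators stay nonzero under the
    substitution, whichever fraction represents r. *)
Lemma PGL_act_frac (F : fieldType) (s : PGL 2 F) (p q : {poly F}) : q != 0 ->
  PGL_act s (tofrac p / tofrac q) =
  poly_subst p (moebius s) / poly_subst q (moebius s).
Proof.
move=> q0; have E := ratfun_numdenE (tofrac p / tofrac q).
have q'0 := denom_ratioP (repr (tofrac p / tofrac q)).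
rewrite /PGL_act /rat_subst; move: (\n_ _) (\d_ _) q'0 E => p' q' q'0 E.
apply/eqP; rewrite eqr_div ?poly_subst_moebius_neq0 //.
(* equal fractions cross-multiply to an identity of polynomials, and this
   identity survives the substitution *)
rewrite /poly_subst -!hornerM -!rmorphM; apply/eqP; congr (map_poly _ _).[_].
by apply/eqP; rewrite -tofrac_eq !tofracM -eqr_div ?tofrac_eq0 // E.
Qed.

Lemma PGL_act_tofrac (F : fieldType) (s : PGL 2 F) (p : {poly F}) :
  PGL_act s (tofrac p) = poly_subst p (moebius s).
Proof.
rewrite -[tofrac p]divr1 -(tofrac1 {poly F}) PGL_act_frac ?oner_neq0 //.
by rewrite {2}/poly_subst rmorph1 hornerC divr1.
Qed.

Lemma PGL_act_zmod_morphism (F : fieldType) (s : PGL 2 F) :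
  zmod_morphism (PGL_act s).
Proof.
move=> r1 r2.
have [p1 [q1 [q1_neq0 ->]]] := ratfunP r1.
have [p2 [q2 [q2_neq0 ->]]] := ratfunP r2.
rewrite !PGL_act_frac // -!mulNr -tofracN !addf_div
  ?tofrac_eq0 ?poly_subst_moebius_neq0 //.
rewrite -!tofracM -tofracD PGL_act_frac ?mulf_neq0 //.
by rewrite /poly_subst rmorphD !rmorphM rmorphN hornerD !hornerM hornerN.
Qed.

Lemma PGL_act_monoid_morphism (F : fieldType) (s : PGL 2 F) :
  monoid_morphism (PGL_act s).
Proof.
split=> [|r1 r2].
  by rewrite -(tofrac1 {poly F}) PGL_act_tofrac /poly_subst rmorph1 hornerC.
have [p1 [q1 [q1_neq0 ->]]] := ratfunP r1.
have [p2 [q2 [q2_neq0 ->]]] := ratfunP r2.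
rewrite mulf_div -!tofracM !PGL_act_frac ?mulf_neq0 // mulf_div.
by rewrite /poly_subst !rmorphM !hornerM.
Qed.

HB.instance Definition _ (F : fieldType) (s : PGL 2 F) :=
  GRing.isZmodMorphism.Build _ _ (@PGL_act F s) (@PGL_act_zmod_morphism F s).
HB.instance Definition _ (F : fieldType) (s : PGL 2 F) :=
  GRing.isMonoidMorphism.Build _ _ (@PGL_act F s) (@PGL_act_monoid_morphism F s).

Lemma PGL_act_ratC (F : fieldType) (s : PGL 2 F) (c : F) :
  PGL_act s (ratC c) = ratC c.
Proof. by rewrite PGL_act_tofrac /poly_subst map_polyC hornerC. Qed.

Lemma PGL_act_ratX (F : fieldType) (s : PGL 2 F) :
  PGL_act s (ratX F) = moebius s.
Proof. by rewrite PGL_act_tofrac /poly_subst map_polyX hornerX. Qed.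

Lemma GL2_mulE (F : fieldType) (A B : GL 2 F) i j :
  GL_mul A B i j = A i 0 * B 0 j + A i 1 * B 1 j.
Proof.
rewrite mxE !big_ord_recl big_ord0 addr0.
by congr (_ + A i _ * B _ j); apply: val_inj.
Qed.

(** Multiplying numerator and denominator by c' x + d' shows that composing Moebius
    maps multiplies their matrices. *)
Lemma moebius_comp (K : fieldType) (a b c d a' b' c' d' x : K) :
  c' * x + d' != 0 -> (c * a' + d * c') * x + (c * b' + d * d') != 0 ->
  ((a * a' + b * c') * x + (a * b' + b * d'))
    / ((c * a' + d * c') * x + (c * b' + d * d'))
  = (a * ((a' * x + b') / (c' * x + d')) + b)
    / (c * ((a' * x + b') / (c' * x + d')) + d).
Proof.
move=> den' den; field.
rewrite den' /=.
by rewrite (_ : _ + _ * _ = (c * a' + d * c') * x + (c * b' + d * d')) //; ring.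
Qed.

(** Acting by s substitutes s(x) for x, so t acts second: x goes to s(x) and then
    to s(t(x)), the Moebius map of the product of the two matrices. *)
Lemma PGL_actM (F : fieldType) (s t : PGL 2 F) :
  PGL_act (s * t)%g = PGL_act t \o PGL_act s.
Proof.
apply/funext; apply: ratfun_rmorph_ext => [c|c|]; rewrite /= ?PGL_act_ratC //.
rewrite [LHS]PGL_act_ratX [PGL_act s _]PGL_act_ratX [moebius s]/moebius moebius_mxE.
rewrite (fmorph_div (PGL_act t)) !(rmorphD (PGL_act t)) !(rmorphM (PGL_act t)) /=.
rewrite !PGL_act_ratC [PGL_act t _]PGL_act_ratX.
rewrite [(s * t)%g]/(PGL_mul s t) /PGL_mul moebiusE.
have := GL2_denom_neq0 (GL_mul (repr s) (repr t)); rewrite /moebius !moebius_mxE.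
have := GL2_denom_neq0 (repr t).
rewrite !GL2_mulE.
move: (repr s) (repr t) => A B.
rewrite !(rmorphD (@ratC F)) !(rmorphM (@ratC F)) /= => den_t den_st.
by rewrite (moebius_comp _ _ den_t den_st).
Qed.

Lemma PGL_act1 (F : fieldType) : PGL_act (1%g : PGL 2 F) = id.
Proof.
apply/funext; apply: (@ratfun_rmorph_ext F _ idfun) => [c|//|].
  exact: PGL_act_ratC.
rewrite [LHS]PGL_act_ratX -[LHS]/(moebius (\pi_(PGL 2 F) (GL_one 2 F))%qT) moebiusE.
rewrite moebius_mxE !mxE /=.
by rewrite !(rmorph0 (@ratC F)) !(rmorph1 (@ratC F)) mul1r addr0 mul0r add0r divr1.
Qed.

Lemma PGL_actK (F : fieldType) (s : PGL 2 F) :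
  cancel (PGL_act s) (PGL_act s^-1%g).
Proof.
move=> r; rewrite -[LHS]/((PGL_act s^-1%g \o PGL_act s) r) -PGL_actM.
by rewrite mulgV PGL_act1.
Qed.

(** The equation a x + b = (c x + d) x forces c = b = 0 and a = d, so the matrix is
    scalar. *)
Lemma moebius_eq_ratX (F : fieldType) (s : PGL 2 F) :
  moebius s = ratX F -> s = 1%g.
Proof.
elim/quotW: s => A; rewrite moebiusE moebius_mxE.
move=> /(canRL (divfK (GL2_denom_neq0 A))) /eqP.
rewrite /ratC /ratX -!tofracM -!tofracD -tofracM tofrac_eq [X in _ == X]mulrC => /eqP E.
have := congr1 (fun p : {poly F} => p`_0) E.
have := congr1 (fun p : {poly F} => p`_1) E.
have := congr1 (fun p : {poly F} => p`_2) E.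
rewrite /= !(coefD, coefMX, coefC) /= !(addr0, add0r) => c0 ad b0.
have ord2 (i : 'I_2) : i = 0 \/ i = 1.
  by case: i => [[|[|//]] lt_i]; [left|right]; apply: val_inj.
apply/esym/PGL_eqP/GL_propP; exists (A 0 0).
  by have := GL2_det_neq0 A; rewrite b0 mul0r subr0 -ad mulf_eq0 orbb.
apply/matrixP => i j; rewrite !mxE.
by case: (ord2 i) => ->; case: (ord2 j) => ->; rewrite ?b0 -?c0 -?ad ?mulr1 ?mulr0.
Qed.

(** The action reduces this to [moebius_eq_ratX]: if s(x) = t(x), then s t^-1 fixes
    x. *)
Lemma moebius_inj (F : fieldType) : injective (@moebius F).
Proof.
move=> s t Est; have : moebius (s * t^-1)%g = ratX F.
  rewrite -PGL_act_ratX PGL_actM /= PGL_act_ratX Est -(PGL_act_ratX t).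
  exact: PGL_actK.
by move=> /moebius_eq_ratX /(congr1 (fun u => u * t)%g); rewrite mulgVK mul1g.
Qed.

Lemma PGL_act_bij (F : fieldType) (s : PGL 2 F) : bijective (PGL_act s).
Proof.
exists (PGL_act s^-1%g); first exact: PGL_actK.
by move=> r; rewrite -{1}[s]invgK PGL_actK.
Qed.

(** * Subfields of F(x) *)

Lemma subfield_full (F : fieldType) (M : set (ratfun F)) :
  subfield M -> (forall c, M (ratC c)) -> M (ratX F) -> M = [set: ratfun F].
Proof.
move=> M_field MC MX; have [_ _ Mdiv] := M_field.
have Mpoly p : tofrac p \in mem M.
  elim/poly_ind: p => [|p c IHp]; first by rewrite inE -[tofrac 0]/(ratC 0).
  have [_ MM] : GRing.mulr_closed (mem M) := GRing.divring_closedBM M_field.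
  have [_ MD] : Algebra.nmod_closed (mem M) := GRing.divring_closedBM M_field.
  rewrite tofracD tofracM.
  by apply: MD; [apply: MM => //|]; rewrite inE; [apply: MX|apply: MC].
rewrite eqEsubset; split=> // r _.
have [p [q [_ ->]]] := ratfunP r.
by have := Mdiv _ _ (Mpoly p) (Mpoly q); rewrite inE; apply.
Qed.

Lemma fixed_field_ratC (F : fieldType) (G : {fset PGL 2 F}) (c : F) :
  fixed_field G (ratC c).
Proof. by move=> s _; apply: PGL_act_ratC. Qed.

Lemma adjoin_root_full (F : fieldType) (K S : set (ratfun F)) :
  (forall c, K (ratC c)) -> S (ratX F) -> field_adjoin K S = [set: ratfun F].
Proof.
move=> KC SX; rewrite eqEsubset; split=> // r _ M [M_field KSM].
rewrite (@subfield_full _ M) // => [c|]; apply: KSM; [left|right] => //.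
Qed.

(** * The orbit polynomial *)

Theorem theorem3 (F : fieldType) (G : {fset PGL 2 F}) (f g : {poly F})
    (Phi : ratfun F) (G_group : group_closed (mem G)) (Phi_fg : Phi = tofrac f / tofrac g)
    (Phi_gen : fixed_field G = rat_adjoin Phi) (fg_coprime : coprimep f g)
    (f_monic : f \is monic) (size_f : size f = (#|` G|).+1)
    (size_g : (size g < (#|` G|).+1)%N) :
  [/\ orbit_poly G = map_poly (@ratC F) f - Phi *: map_poly (@ratC F) g,
      is_galois_group [set` G] (@PGL_act F) (rat_adjoin Phi) (orbit_poly G)
    & is_splitting_field (rat_adjoin Phi) (orbit_poly G)].
Proof.
have G1 : 1%g \in G by case: G_group.
(* If g = 0, then f is a unit, but its degree |G| is positive. *)
have g0 : g != 0.
  apply: contraTneq fg_coprime => ->; rewrite coprimep0 -size_poly_eq1 size_f eqSS.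
  by rewrite cardfs_eq0; apply/fset0Pn; exists 1%g.
have Phi_fixed : fixed_field G Phi.
  by rewrite Phi_gen; apply: sub_gen_smallest; right.
pose rs := [seq PGL_act s (ratX F) | s <- G].
have rs_uniq : uniq rs.
  rewrite map_inj_uniq ?fset_uniq // => s t; rewrite !PGL_act_ratX.
  exact: moebius_inj.
have orbit_rs : orbit_poly G = \prod_(z <- rs) ('X - z%:P) by rewrite big_map.
have orbit_fg : orbit_poly G = map_poly (@ratC F) f - Phi *: map_poly (@ratC F) g.
  set p := RHS.
  have lt_size : (size (- (Phi *: map_poly (@ratC F) g)) < size (map_poly (@ratC F) f))%N.
    rewrite size_polyN (leq_ltn_trans (size_scale_leq _ _)) //.
    by rewrite !size_map_poly size_f.
  have size_p : size p = (size rs).+1.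
    by rewrite size_polyDl // size_map_poly size_f size_map cardfE.
  have p_monic : p \is monic.
    by rewrite monicE lead_coefDl // -monicE map_monic.
  suffices p_roots : all (root p) rs.
    rewrite orbit_rs (all_roots_prod_XsubC size_p) ?uniq_rootsE //.
    by rewrite (monicP p_monic) scale1r.
  apply/allP => _ /mapP[s sG ->]; rewrite PGL_act_ratX.
  have Phi_s : Phi = poly_subst f (moebius s) / poly_subst g (moebius s).
    by rewrite -(PGL_act_frac s f g0) -Phi_fg; apply/esym/Phi_fixed.
  have {}Phi_s : Phi * poly_subst g (moebius s) = poly_subst f (moebius s).
    by rewrite Phi_s divfK // poly_subst_moebius_neq0.
  by rewrite rootE hornerD hornerN hornerZ subr_eq0; apply/eqP/esym.
have orbit_fixed i : fixed_field G (orbit_poly G)`_i.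
  move=> s sG; rewrite orbit_fg coefB coefZ !coef_map /=.
  by rewrite rmorphB rmorphM /= !PGL_act_ratC Phi_fixed.
have ratX_rs : ratX F \in rs.
  by apply/mapP; exists 1%g => //; rewrite PGL_act1.
have orbit_split : is_splitting_field (rat_adjoin Phi) (orbit_poly G).
  rewrite -Phi_gen; split=> //; exists rs; first by rewrite orbit_rs eqpxx.
  by apply: adjoin_root_full => // c; apply: fixed_field_ratC.
split=> //; split=> //; first by rewrite orbit_rs separable_prod_XsubC.
  by move=> s t _ _; apply: PGL_actM.
rewrite -Phi_gen; split.
- move=> s sG; split; [exact: PGL_act_zmod_morphism | exact: PGL_act_monoid_morphism
    | exact: PGL_act_bij |].
  by move=> r; rewrite inE => /(_ s sG).
- move=> s t _ _ /(congr1 (fun phi => phi (ratX F))); rewrite !PGL_act_ratX.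
  exact: moebius_inj.
move=> phi [phiB phiM _ phiK].
pose phi' : {rmorphism ratfun F -> ratfun F} :=
  HB.pack phi (GRing.isZmodMorphism.Build _ _ phi phiB)
    (GRing.isMonoidMorphism.Build _ _ phi phiM).
have phi_fixed r : fixed_field G r -> phi r = r by move=> Gr; apply: phiK; rewrite inE.
(* phi permutes the roots of the orbit polynomial, and x is one of them *)
have /mapP[s sG phiX] : phi (ratX F) \in rs.
  rewrite -root_prod_XsubC -orbit_rs rootE.
  rewrite (_ : orbit_poly G = map_poly phi' (orbit_poly G)).
    rewrite (horner_map phi') -/(root _ _).
    have /rootP -> : root (orbit_poly G) (ratX F) by rewrite orbit_rs root_prod_XsubC.
    by rewrite rmorph0.
  by apply/polyP => i; rewrite coef_map; apply/esym/phi_fixed/orbit_fixed.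
exists s => //; apply/funext => r; apply/esym.
apply: (@ratfun_rmorph_ext F phi' (PGL_act s)) => [c|c|//].
  exact/phi_fixed/fixed_field_ratC.
exact: PGL_act_ratC.
Qed.
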